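(* Let $G$ be a unimodular lcsc group with Haar measure $m_G$, let $d$ be a left-invariant metric on $G$ whose closed balls $B_t=\{g: d(e,g)\le t\}$ are compact of positive measure, and let $\beta_t$ be the probability measure with density $\chi_{B_t}/m_G(B_t)$. Fix $r>0$ and $1<p<\infty$, and suppose that for all $F\in L^p(G)$, $$\Big\|\sup_{0<t\le r}|\rho(\beta_t)F|\Big\|_{L^p(G)}\le C_p\|F\|_{L^p(G)},\qquad \rho(\beta_t)F(g)=\int_G F(gh)\,d\beta_t(h).$$ Then (1) for every measure-preserving action of $G$ on a $\sigma$-finite measure space $(X,m)$, every $f\in L^p(X)$ and every $R\ge 2r$, $$\Big\|\sup_{0<t\le r}|\pi(\beta_t)f|\Big\|_{L^p(X)}\le C_p\Big(\frac{m_G(B_R)}{m_G(B_{R-r})}\Big)^{1/p}\|f\|_{L^p(X)};$$ (2) consequently, if $\lim_{R\to\infty}m_G(B_R)/m_G(B_{R-r})=1$ for every $r>0$ and the hypothesis holds for every $r>0$ with the same constant $C_p$, then $\|\sup_{0<t<\infty}|\pi(\beta_t)f|\|_{L^p(X)}\le C_p\|f\|_{L^p(X)}$ in every such action.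
   Context: For a measure-preserving action of $G$ on $(X,m)$ and a probability measure $\mu$ on $G$, $\pi(\mu)f(x)=\int_G f(g^{-1}x)\,d\mu(g)$. *)

(* Defs.v *)
From HB Require Import structures.
From mathcomp Require Import all_boot all_order all_algebra.
From mathcomp Require Import all_classical all_reals all_analysis.
Set Implicit Arguments. Unset Strict Implicit. Unset Printing Implicit Defensive.
Import Order.TTheory GRing.Theory Num.Theory.
Import numFieldNormedType.Exports.
Local Open Scope classical_set_scope.
Local Open Scope ring_scope.

Notation Borel G := (g_sigma_algebraType (@open G)).

Section defs.
Context (G : ptopologicalType) (mul : G -> G -> G) (inv : G -> G) (e : G).

Definition is_group : Prop :=
  [/\ (forall x y z, mul x (mul y z) = mul (mul x y) z),
      (forall x, mul e x = x /\ mul x e = x) &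
      (forall x, mul (inv x) x = e /\ mul x (inv x) = e)].

Definition lcsc_group : Prop :=
  [/\ is_group,
      continuous (fun z : G * G => mul z.1 z.2),
      continuous inv,
      hausdorff_space G &
      locally_compact [set: G] /\ @second_countable G].

Context {R : realType}.

Definition unimodular_haar (mG : {measure set (Borel G) -> \bar R}) : Prop :=
  [/\ (forall g (A : set (Borel G)), measurable A ->
         mG ((mul g) @^-1` A) = mG A),
      (forall g (A : set (Borel G)), measurable A ->
         mG ((fun x => mul x g) @^-1` A) = mG A),
      (forall K : set G, compact K -> (mG K < +oo)%E) &
      (forall U : set G, open U -> U !=set0 -> (0 < mG U)%E)].

Definition left_inv_metric (dist : G -> G -> R) : Prop :=
  [/\ (forall x y, dist x y = 0 <-> x = y),
      (forall x y, dist x y = dist y x),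
      (forall x y z, dist x z <= dist x y + dist y z) &
      (forall g x y, dist (mul g x) (mul g y) = dist x y)].

Definition cball (dist : G -> G -> R) (t : R) : set G := [set g | dist e g <= t].

Definition rho_beta (mG : {measure set (Borel G) -> \bar R})
    (dist : G -> G -> R) (t : R) (F : G -> R) (g : G) : \bar R :=
  ((fine (mG (cball dist t)))^-1)%:E *
    (\int[mG]_(h in (cball dist t : set (Borel G))) (F (mul g h))%:E)%E.

Definition pi_beta (mG : {measure set (Borel G) -> \bar R})
    (dist : G -> G -> R) {dX} {X : measurableType dX} (act : G -> X -> X)
    (t : R) (f : X -> R) (x : X) : \bar R :=
  ((fine (mG (cball dist t)))^-1)%:E *
    (\int[mG]_(h in (cball dist t : set (Borel G))) (f (act (inv h) x))%:E)%E.

Definition maxfun {T} (I : set R) (A : R -> T -> \bar R) (y : T) : \bar R :=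
  ereal_sup [set `|A t y|%E | t in I].

Definition mp_action {dX} {X : measurableType dX}
    (m : {measure set X -> \bar R}) (act : G -> X -> X) : Prop :=
  [/\ (forall x, act e x = x),
      (forall g h x, act (mul g h) x = act g (act h x)),
      measurable_fun [set: Borel G * X] (fun z : Borel G * X => act z.1 z.2) &
      (forall g (A : set X), measurable A -> m (act g @^-1` A) = m A)].

End defs.

(* Main.v *)
Require Import Defs.
From HB Require Import structures.
From mathcomp Require Import all_boot all_order all_algebra.
From mathcomp Require Import all_classical all_reals all_analysis.
From mathcomp Require Import measurable_realfun.
Import Order.TTheory GRing.Theory Num.Theory.
Import numFieldNormedType.Exports.
Local Open Scope classical_set_scope.
Local Open Scope ring_scope.

(** Calderon's transference.  For [x] in [X] put [F_x g = 1_(B_R0)(g) f(g^-1 x)].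
If [t <= r], [g] lies in [B_(R0-r)] and [h] in [B_t], then [gh] lies in [B_R0] by
left invariance of the metric, so [rho(beta_t) F_x g = pi(beta_t) f (g^-1 x)].
The maximal inequality on [G], applied to [F_x] for almost every [x], bounds
the integral over [B_(R0-r)] of the [p]-th power of the maximal function at
[g^-1 x] by [C^p] times the integral over [B_R0] of [|f(g^-1 x)|^p].
Integrating in [x], Tonelli and invariance of [m] turn the two sides into
[m_G(B_(R0-r)) ||sup_t |pi(beta_t) f| ||^p] and [C^p m_G(B_R0) ||f||^p].
For the second part let [R0] and then [r] tend to infinity, the latter by
monotone convergence.  The supremum over [t] is measurable because closed
balls make [t |-> pi(beta_t) f x] right-continuous, so that rational radii
suffice. *)

(** * Integrals and p-norms on an abstract measure space *)

Section generic.
Local Open Scope ereal_scope.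
Context d (T : measurableType d) (R : realType).
Implicit Types (mu : {measure set T -> \bar R}).

(* No measurability is needed because the integral of a nonnegative function is
   defined as a supremum over simple functions below it.  This spares
   a proof that maximal functions on [G] are measurable, which would require
   the Borel sets of [G * G] to be generated by rectangles. *)
Lemma ge0_le_integral_nomeas mu (D : set T) (f1 f2 : T -> \bar R) :
  (forall x, D x -> 0 <= f1 x) -> (forall x, D x -> f1 x <= f2 x) ->
  \int[mu]_(x in D) f1 x <= \int[mu]_(x in D) f2 x.
Proof.
move=> f10 f12; rewrite !ge0_integralE//; last first.
  by move=> x Dx; rewrite (le_trans (f10 _ Dx)) ?f12.
apply: le_ereal_sup => _ [h /= hf <-]; exists h => //= x.
apply: (le_trans (hf x)); rewrite /patch; case: ifP => //.
by rewrite inE => /f12.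
Qed.

(** Bundles the property of being sigma-finite into the measure, so that Tonelli's theorem for
    sigma-finite measure structures applies to [mG] and [m]. *)
Lemma sigma_finite_measureP mu : sigma_finite [set: T] mu ->
  exists nu : {sigma_finite_measure set T -> \bar R},
    (nu : {measure set T -> \bar R}) = mu.
Proof.
case: mu => m [c1 c2] sf.
pose mu := @Measure.Pack _ _ _ m (@Measure.Class _ _ _ m c1 c2).
pose s1 := @isSigmaFinite.Build _ _ _ m sf.
pose s2 := isSFinite.Build _ _ _ mu (@sfinite_measure_sigma_finite _ _ _ mu sf).
by exists (HB.pack_for {sigma_finite_measure set T -> \bar R} m c1 c2 s1 s2).
Qed.

End generic.

Lemma ge0_le_poweR (R : realType) (q : R) (a b : \bar R) :
  (0 <= q)%R -> (0 <= a)%E -> (a <= b)%E -> (a `^ q <= b `^ q)%E.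
Proof.
move=> q0 a0 ab; apply: gt0_ler_poweR => //; rewrite in_itv/= leey andbT//.
exact: le_trans ab.
Qed.

(** Monotone convergence for the p-th powers of the [M n]. It serves to pass from radii bounded by
    an integer to all positive radii. *)
Lemma Lnorm_sup_le d (T : measurableType d) (R : realType)
    (mu : {measure set T -> \bar R}) (p : R) (M : nat -> T -> \bar R)
    (N : T -> \bar R) (c : \bar R) :
  (0 < p)%R -> (forall n, measurable_fun [set: T] (M n)) ->
  (forall n x, 0 <= M n x)%E ->
  (forall x, {homo M^~ x : m n / (m <= n)%N >-> (m <= n)%E}) ->
  (forall x, 0 <= N x <= ereal_sup (range (M^~ x)))%E ->
  (forall n, Lnorm mu p%:E (M n) <= c)%E -> (Lnorm mu p%:E N <= c)%E.
Proof.
move=> p0 mM M0 ndM NM Mc.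
have c0 : (0 <= c)%E by exact: le_trans (Lnorm_ge0 _ _ _) (Mc 0%N).
have pN0 : p != 0%R by rewrite gt_eqF.
have ip0 : (0 <= p^-1)%R by rewrite invr_ge0 ltW.
pose h n x := (`|M n x| `^ p)%E.
have ndh x : {homo h^~ x : m n / (m <= n)%N >-> (m <= n)%E}.
  move=> k n kn; apply: ge0_le_poweR; [exact: ltW|exact: abse_ge0|].
  by rewrite !gee0_abs//; exact: ndM.
have mh n : measurable_fun [set: T] (h n).
  by apply: (measurableT_comp (measurable_poweR p)); exact: measurableT_comp.
have h0 n x : (0 <= h n x)%E by exact: poweR_ge0.
have NE : (\int[mu]_x `|N x| `^ p <= c `^ p)%E.
  apply: (@le_trans _ _ (\int[mu]_x limn (h^~ x))%E).
    apply: ge0_le_integral_nomeas => x _; first exact: poweR_ge0.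
    have /andP[N0 Nsup] := NM x.
    rewrite (cvg_lim _ (ereal_nondecreasing_cvgn (ndh x)))//.
    set L := ereal_sup _; rewrite gee0_abs//.
    have L0 : (0 <= L)%E.
      by apply: le_trans (h0 0%N x) _; apply: ereal_sup_ubound; exists 0%N.
    (* [L] is a supremum of p-th powers, so each [M n x] is at most [L] to the power [1/p]. Hence so
       is [N x], and raising back to the power [p] gives the bound. *)
    have LE : L = ((L `^ p^-1) `^ p)%E by rewrite -poweRrM mulVf// poweRe1.
    rewrite LE; apply: ge0_le_poweR; [exact: ltW|by []|].
    apply: le_trans Nsup _; apply: ge_ereal_sup => _ [n _ <-].
    have -> : M n x = ((h n x) `^ p^-1)%E.
      by rewrite /h -poweRrM mulfV// gee0_abs// poweRe1.
    by apply: ge0_le_poweR => //; apply: ereal_sup_ubound; exists n.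
  rewrite monotone_convergence//.
  apply: lime_le.
    apply: ereal_nondecreasing_is_cvgn => k n kn.
    by apply: ge0_le_integral => // x _; exact: ndh.
  apply: nearW => n; rewrite -(poweR_Lnorm mu (M n) pN0).
  by apply: ge0_le_poweR; [exact: ltW|exact: Lnorm_ge0|exact: Mc].
rewrite unlock; have -> : c = ((c `^ p) `^ p^-1)%E by rewrite -poweRrM mulfV// poweRe1.
apply: ge0_le_poweR => //; apply: integral_ge0 => x _; exact: poweR_ge0.
Qed.

(** * Right-continuity of ball averages in the radius *)

Section ball_averages.
Local Open Scope ereal_scope.
Context d (T : measurableType d) (R : realType).
Variables (mu : {measure set T -> \bar R}) (N : T -> R).
Local Notation B t := [set h | (N h <= t)%R].
Hypothesis mB : forall t, (0 < t)%R -> measurable (B t).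
Hypothesis B_lty : forall t, (0 < t)%R -> mu (B t) < +oo.
Hypothesis B_gt0 : forall t, (0 < t)%R -> 0 < mu (B t).

(** Dominated convergence on [B s], with the modulus of [psi] as dominating function. Approaching
    [t] from above is what makes the restrictions to the balls converge pointwise. *)
Lemma cvg_integral_ball (psi : T -> \bar R) (t s : R) (q : nat -> R) :
  (0 < t)%R -> (t < s)%R -> measurable_fun [set: T] psi ->
  mu.-integrable (B s) psi ->
  (forall n, (t < q n <= s)%R) -> q n @[n --> \oo] --> t ->
  \int[mu]_(h in B (q n)) psi h @[n --> \oo] --> \int[mu]_(h in B t) psi h.
Proof.
move=> t0 ts mpsi ipsi qts qt.
have s0 : (0 < s)%R by exact: lt_trans ts.
have q0 n : (0 < q n)%R by have /andP[+ _] := qts n; exact: lt_trans.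
have subB u : (u <= s)%R -> B s `&` B u = B u.
  by move=> us; apply/setIidPr => h /= hu; exact: le_trans us.
have -> : \int[mu]_(h in B t) psi h = \int[mu]_(h in B s) (psi \_ (B t)) h.
  by rewrite -integral_mkcondr subB// ltW.
have -> : (fun n => \int[mu]_(h in B (q n)) psi h) =
    (fun n => \int[mu]_(h in B s) (psi \_ (B (q n))) h).
  by apply/funext => n; rewrite -integral_mkcondr subB//; case/andP: (qts n).
have mpt u : (0 < u)%R -> measurable_fun (B s) (psi \_ (B u)).
  move=> u0; apply/measurable_restrict; [exact: mB|exact: mB|].
  exact: measurable_funS mpsi.
have [] := @dominated_convergence _ _ _ mu _ (mB _ s0)
  (fun n => psi \_ (B (q n))) (psi \_ (B t)) (abse \o psi).
- by move=> n; exact: mpt.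
- exact: mpt.
- apply: aeW => h _.
  (* A point of the closed ball [B t] lies in every [B (q n)]; a point outside it has [q n < N h]
     eventually. Either way the sequence is eventually constant. *)
  have [hts|tht] := leP (N h) t.
    apply: cvg_near_cst; apply: nearW => n.
    rewrite !patchE !mem_set//=; apply: le_trans hts _.
    by have /andP[/ltW] := qts n.
  apply: cvg_near_cst; near=> n.
  rewrite !patchE !memNset//=; first by apply/negP; rewrite -ltNge.
  apply/negP; rewrite -ltNge; near: n.
  exact: (cvgr_lt _ qt).
- exact: integrable_abse.
- apply: aeW => h n _ /=; rewrite patchE; case: ifP => // _.
  by rewrite abse0.
- by [].
Unshelve. all: by end_near.
Qed.

(** The positive or the negative part has infinite integral, and the difference of the two integrals
    is then infinite. *)
Lemma abse_integral_notin (D : set T) (psi : T -> \bar R) :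
  measurable D -> measurable_fun D psi -> ~ mu.-integrable D psi ->
  `|\int[mu]_(x in D) psi x| = +oo.
Proof.
move=> mD mpsi nint.
have [pf|pf] := boolP (\int[mu]_(x in D) psi^\+ x \is a fin_num); last first.
  have poo : \int[mu]_(x in D) psi^\+ x = +oo.
    by apply/eqP; move: pf; rewrite ge0_fin_numE ?integral_ge0// -leNgt leye_eq.
  (* If both parts are infinite, the convention that [+oo - +oo] is [-oo] still gives modulus
     [+oo]. *)
  rewrite integralE poo; case: (\int[mu]_(x in D) psi^\- x) => //.
have [nf|nf] := boolP (\int[mu]_(x in D) psi^\- x \is a fin_num); last first.
  have noo : \int[mu]_(x in D) psi^\- x = +oo.
    by apply/eqP; move: nf; rewrite ge0_fin_numE ?integral_ge0// -leNgt leye_eq.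
  by rewrite integralE noo addeNy.
exfalso; apply: nint; apply/integrableP; split => //.
rewrite (eq_integral (fun x => psi^\+ x + psi^\- x)); last first.
  by move=> x _; rewrite -[LHS]/((abse \o psi) x) fune_abse.
rewrite ge0_integralD//; [|exact: measurable_funepos|exact: measurable_funeneg].
by rewrite lte_add_pinfty// ltey_eq ?pf ?nf.
Qed.

Local Notation avg phi t :=
  (((fine (mu (B t)))^-1)%:E * \int[mu]_(h in B t) (phi h)%:E).

(** If [phi] is integrable over no ball of rational radius in []t, s[], the right side is [+oo].
    Otherwise one such ball provides domination, and the averages over rational radii decreasing to
    [t] converge to the one at [t]. *)
Lemma ball_avg_le_sup_rat (phi : T -> R) (t s : R) :
  measurable_fun [set: T] phi -> (0 < t)%R -> (t < s)%R ->
  `|avg phi t| <=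
    ereal_sup [set `|avg phi (ratr q)| | q in [set q : rat | ratr q \in `]t, s[%R]].
Proof.
move=> mphi t0 ts; set S := ereal_sup _.
have mphiE : measurable_fun [set: T] (EFin \o phi) by exact/measurable_EFinP.
have muB u : (0 < u)%R -> mu (B u) \is a fin_num.
  by move=> u0; rewrite ge0_fin_numE// B_lty.
have fineB u : (0 < u)%R -> (0 < fine (mu (B u)))%R.
  by move=> u0; rewrite fine_gt0// B_gt0//= B_lty.
have [[q0 [q0ts iq0]]|noint] := pselect (exists q0 : rat,
    ratr q0 \in `]t, s[%R /\ mu.-integrable (B (ratr q0)) (EFin \o phi)); last first.
  have [q qts] := rat_in_itvoo ts.
  have q0 : (0 < ratr q :> R)%R.
    by move: qts; rewrite in_itv/= => /andP[+ _]; exact: lt_trans.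
  suff : `|avg phi (ratr q)| = +oo.
    move=> qoo; apply: (@le_trans _ _ +oo); first exact: leey.
    by rewrite -qoo; apply: ereal_sup_ubound; exists q.
  rewrite abseM abse_integral_notin.
  - have cP : (0 < (fine (mu (B (ratr q))))^-1)%R by rewrite invr_gt0 fineB.
    by rewrite gt0_muley//= lte_fin gtr0_norm.
  - exact: mB.
  - exact: measurable_funS mphiE.
  - by move=> ?; apply: noint; exists q.
have q0t : (t < ratr q0)%R by move: q0ts; rewrite in_itv => /andP[].
have q0s : (ratr q0 < s)%R by move: q0ts; rewrite in_itv => /andP[].
(* The minimum with [ratr q0] keeps the balls inside the one where [phi] is integrable; the other
   bound forces convergence to [t]. *)
have /choice[q qP] : forall n, exists q : rat,
    ratr q \in `]t, (Num.min (ratr q0) (t + n.+1%:R^-1))%R[%R.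
  by move=> n; apply: rat_in_itvoo; rewrite lt_min q0t ltrDl invr_gt0 ltr0n.
have qlt n : (t < (ratr (q n) : R) <= ratr q0)%R.
  by move: (qP n); rewrite in_itv/= lt_min => /and3P[-> qq0 _]/=; exact: ltW.
have qt : (ratr (q n) : R) @[n --> \oo] --> t.
  apply: (@squeeze_cvgr _ _ _ _ (cst t) (fun n => t + n.+1%:R^-1)%R).
  - apply: nearW => n; move: (qP n); rewrite in_itv/= lt_min.
    by move=> /and3P[tq _ qn]; rewrite !ltW.
  - exact: cvg_cst.
  - by rewrite -[X in _ --> X]addr0; apply: cvgD; [exact: cvg_cst|exact: cvg_harmonic].
have q0gt0 : (0 < ratr q0 :> R)%R by exact: lt_trans q0t.
have cphi := cvg_integral_ball _ _ _ _ t0 q0t mphiE iq0 qlt qt.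
(* The normalising masses converge by the same lemma, applied to the constant 1. *)
have c1 : mu (B (ratr (q n))) @[n --> \oo] --> mu (B t).
  have := cvg_integral_ball (cst 1) _ _ _ t0 q0t _ _ qlt qt.
  rewrite integral_cst; last exact: mB.
  rewrite mul1e.
  rewrite (_ : (fun n => _) = (fun n => mu (B (ratr (q n))))); last first.
    apply/funext => n; rewrite integral_cst ?mul1e//; apply: mB.
    by have /andP[+ _] := qlt n; exact: lt_trans.
  apply; first exact: measurable_cst.
  apply/integrableP; split; first exact: measurable_cst.
  rewrite (eq_integral (cst 1)); last by move=> h _; rewrite /= normr1.
  by rewrite integral_cst; [rewrite mul1e B_lty|exact: mB].
have : `|avg phi (ratr (q n))| @[n --> \oo] --> `|avg phi t|.
  apply: cvg_abse; apply: cvgeM => //.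
  - apply: mule_def_fin => //; apply: integrable_fin_num; first exact: mB.
    apply: integrableS iq0; [exact: mB|exact: mB|].
    by move=> h /= ht; exact: le_trans (ltW q0t).
  - apply: cvg_EFin; first exact: nearW.
    apply: cvgV; first by rewrite gt_eqF// fineB.
    by apply: fine_cvg; rewrite fineK// muB.
apply: cvge_le; apply: nearW => n; apply: ereal_sup_ubound; exists (q n) => //.
move: (qlt n); rewrite /= in_itv/= => /andP[-> qq0]/=; exact: le_lt_trans q0s.
Qed.
End ball_averages.

(** * Measurability of maximal functions and of partial integrals *)

Section maximal_measurability.
Local Open Scope ereal_scope.
Context {R : realType}.

Lemma maxfun_ge0 T (I : set R) (A : R -> T -> \bar R) r y :
  I r -> 0 <= maxfun I A y.
Proof.
move=> Ir; apply: (le_trans (abse_ge0 (A r y))).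
by apply: ereal_sup_ubound; exists r.
Qed.

(** The supremum reduces to a countable one, over the rationals of [I] together with [r]. The point
    [r] is separate because it may be the right endpoint of [I], with no rational of [I] above
    it. *)
Lemma measurable_maxfun d (T : measurableType d) (I : set R) (r : R)
    (A : R -> T -> \bar R) :
  I r -> (forall t, I t -> measurable_fun [set: T] (A t)) ->
  (forall t, I t -> t = r \/ exists2 s, [set` `]t, s[%R] `<=` I & forall x,
     `|A t x| <= ereal_sup
       [set `|A (ratr q) x| | q in [set q : rat | ratr q \in `]t, s[%R]]) ->
  measurable_fun [set: T] (maxfun I A).
Proof.
move=> Ir mA dA.
(* Index 0 yields [r], index [k.+1] the rational coded by [k]; [r] is also the default when that
   rational is absent or outside [I]. *)
pose u (n : nat) : R := if n is k.+1 then
  (if unpickle k is Some q then if ratr q \in I then ratr q else r else r) else r.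
have Iu n : I (u n).
  by case: n => //= n; case: unpickle => // q; case: ifPn => // /set_mem.
suff -> : maxfun I A = (fun x => esups (fun n => `|A (u n) x|) 0%N).
  apply: measurable_fun_esups => n; apply: measurableT_comp => //.
  exact: mA.
apply/funext => x; rewrite /esups/= /maxfun.
apply/eqP; rewrite eq_le; apply/andP; split.
  apply: ge_ereal_sup => _ [t It <-].
  have [->|[s sI tle]] := dA _ It.
    by apply: ereal_sup_ubound; exists 0%N.
  apply: le_trans (tle x) _; apply: ge_ereal_sup => _ [q /= /sI qI <-].
  apply: ereal_sup_ubound; exists (pickle q).+1 => //.
  by rewrite /u pickleK mem_set.
by apply: le_ereal_sup => _ [n _ <-]; exists (u n).
Qed.

(** Tonelli gives the nonnegative case, and the general one follows by subtracting the integrals of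
    the two parts. It yields measurability in [x] of averages of a signed [f]. *)
Lemma measurable_fun_integral_l d1 d2 (T1 : measurableType d1) (T2 : measurableType d2)
    (mu : {measure set T1 -> \bar R}) (D : set T1) (k : T1 * T2 -> \bar R) :
  sigma_finite [set: T1] mu -> measurable D -> measurable_fun [set: T1 * T2] k ->
  measurable_fun [set: T2] (fun y => \int[mu]_(x in D) k (x, y)).
Proof.
move=> /sigma_finite_measureP[nu <-] mD mk.
have ge0_case (l : T1 * T2 -> \bar R) : (forall z, 0 <= l z) ->
    measurable_fun [set: T1 * T2] l ->
    measurable_fun [set: T2] (fun y => \int[nu]_(x in D) l (x, y)).
  move=> l0 ml.
  (* Restricting [l] to the strip over [D] turns the integral over [D] into one over the whole
     space. *)
  have := @measurable_fun_fubini_tonelli_G _ _ _ _ _ nu (l \_ (D `*` setT)).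
  rewrite (_ : fubini_G _ _ = fun y => \int[nu]_(x in D) l (x, y)); last first.
    apply/funext => y; rewrite /fubini_G [RHS]integral_mkcond.
    apply: eq_integral => x _; rewrite !patchE.
    by congr (if _ then _ else _); apply/idP/idP; rewrite !inE//= => -[].
  apply; first apply: (measurable_restrictT l (measurableX mD measurableT)).1.
    exact: measurable_funTS.
  by move=> z; rewrite patchE; case: ifP => // _; exact: l0.
rewrite (_ : (fun _ => _) = (fun y => \int[nu]_(x in D) k^\+ (x, y) -
   \int[nu]_(x in D) k^\- (x, y))); last first.
  apply/funext => y; rewrite integralE.
  by congr (_ - _); apply: eq_integral => x _; rewrite ?funeposE ?funenegE.
apply: emeasurable_funB; apply: ge0_case => //.
- exact: measurable_funepos.
- exact: measurable_funeneg.
Qed.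

Lemma fubini_tonelli_sigma_finite d1 d2 (T1 : measurableType d1)
    (T2 : measurableType d2) (m1 : {measure set T1 -> \bar R})
    (m2 : {measure set T2 -> \bar R}) (k : T1 * T2 -> \bar R) :
  sigma_finite [set: T1] m1 -> sigma_finite [set: T2] m2 ->
  measurable_fun [set: T1 * T2] k -> (forall z, 0 <= k z) ->
  \int[m1]_x \int[m2]_y k (x, y) = \int[m2]_y \int[m1]_x k (x, y).
Proof.
move=> /sigma_finite_measureP[n1 <-] /sigma_finite_measureP[n2 <-].
exact: fubini_tonelli.
Qed.

End maximal_measurability.

(** * Borel measurability of closed sets and continuous maps *)

Section borel.
Context {G : ptopologicalType}.

Lemma closed_borel_measurable (A : set G) : closed A -> measurable (A : set (Borel G)).
Proof.
move=> cA; rewrite -[A]setCK; apply: measurableC; apply: sub_sigma_algebra.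
exact: closed_openC.
Qed.

Lemma continuous_borel_measurable (f : G -> G) : continuous f ->
  measurable_fun [set: Borel G] (f : Borel G -> Borel G).
Proof.
move=> /continuousP cf.
apply: (@measurability _ _ (Borel G) (Borel G) setT f (@open G)) => //.
by move=> _ [U oU <-]; rewrite setTI; apply: sub_sigma_algebra; exact: cf.
Qed.

End borel.

(** * Averages along an action and its orbits *)

Section action_averages.
Local Open Scope ereal_scope.
Context (R : realType) (G : ptopologicalType) (mul : G -> G -> G) (inv : G -> G)
  (e : G) (mG : {measure set (Borel G) -> \bar R}) (dist : G -> G -> R).
Hypothesis Ggroup : is_group mul inv e.
Hypothesis inv_continuous : continuous inv.
Hypothesis dist_left_inv : left_inv_metric mul dist.
Local Notation B t := (cball e dist t : set (Borel G)).
Hypothesis measurable_ball : forall t, (0 < t)%R -> measurable (B t).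
Hypothesis ball_lty : forall t, (0 < t)%R -> mG (B t) < +oo.
Hypothesis ball_gt0 : forall t, (0 < t)%R -> 0 < mG (B t).

Lemma sigma_finite_balls : sigma_finite [set: Borel G] mG.
Proof.
(* The shift by one keeps all radii positive, as the hypotheses on balls require. *)
exists (fun n => B n.+1%:R) => [|n]; last first.
  by split; [exact: measurable_ball|exact: ball_lty].
apply/seteqP; split => // g _; exists (Num.truncn (dist e g)) => //=.
by rewrite /cball/= ltW// truncnS_gt.
Qed.

Context {dX} {X : measurableType dX} (m : {measure set X -> \bar R})
  (act : G -> X -> X).
Hypothesis m_sigma_finite : sigma_finite [set: X] m.
Hypothesis act_mp : mp_action mul e m act.

Lemma measurable_act_inv : measurable_fun [set: Borel G * X]
  (fun z : Borel G * X => act (inv z.1) z.2).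
Proof.
have [_ _ mact _] := act_mp.
pose swap (z : Borel G * X) : Borel G * X := (inv z.1, z.2).
suff : measurable_fun [set: Borel G * X] swap by exact: measurableT_comp mact.
apply: measurable_fun_pair => //=.
apply: measurableT_comp; last exact: measurable_fst.
exact: continuous_borel_measurable.
Qed.

(** After Tonelli the inner integral is over [x] with [g] fixed, and invariance of [m] makes it
    independent of [g]. *)
Lemma integral_act_inv (D : set (Borel G)) (K : X -> \bar R) :
  measurable D -> measurable_fun [set: X] K -> (forall x, 0 <= K x) ->
  \int[m]_x \int[mG]_(g in D) K (act (inv g) x) = mG D * \int[m]_x K x.
Proof.
move=> mD mK K0.
have [act1 actM mact act_inv] := act_mp.
have mactg g : measurable_fun [set: X] (act g : X -> X).
  exact: (@measurable_fun_pair2 _ _ _ _ _ _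
    (fun z : Borel G * X => act z.1 z.2) g mact).
pose k (z : Borel G * X) := K (act (inv z.1) z.2).
pose l := k \_ (D `*` setT).
transitivity (\int[m]_x \int[mG]_g l (g, x)).
  apply: eq_integral => x _; rewrite [LHS]integral_mkcond.
  apply: eq_integral => g _; rewrite /l !patchE.
  by congr (if _ then _ else _); apply/idP/idP; rewrite !inE//= => -[].
rewrite -fubini_tonelli_sigma_finite; last 4 first.
- exact: sigma_finite_balls.
- exact: m_sigma_finite.
- apply: (measurable_restrictT k (measurableX mD measurableT)).1.
  by apply: measurable_funTS; apply: measurableT_comp => //; exact: measurable_act_inv.
- by move=> z; rewrite /l patchE; case: ifP => // _; exact: K0.
transitivity (\int[mG]_(g in D) \int[m]_x K x); last first.
  by rewrite integral_cst// muleC.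
rewrite [RHS]integral_mkcond; apply: eq_integral => g _.
rewrite patchE; case: ifPn => gD; last first.
  apply: integral0_eq => x _; rewrite /l patchE ifF//.
  by apply: contraNF gD; rewrite !inE => -[].
transitivity (\int[m]_x (K \o act (inv g)) x).
  by apply: eq_integral => x _; rewrite /l patchE mem_set//; split => //; exact/set_mem.
(* Change of variables: the image of [m] under the action of [inv g] is [m] itself. *)
have := ge0_integral_pushforward (mactg (inv g)) m measurableT mK.
rewrite preimage_setT => <-; last by move=> x _; exact: K0.
apply: eq_measure_integral => A mA _; exact: act_inv.
Qed.

Lemma measurable_pi_beta t (f : X -> R) : (0 < t)%R ->
  measurable_fun [set: X] f ->
  measurable_fun [set: X] (pi_beta inv e mG dist act t f).
Proof.
move=> t0 mf; apply: measurable_funeM.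
apply: (@measurable_fun_integral_l _ _ _ _ _ mG (B t)
  (fun z : Borel G * X => (f (act (inv z.1) z.2))%:E)).
- exact: sigma_finite_balls.
- exact: measurable_ball.
- by apply/measurable_EFinP; apply: measurableT_comp => //; exact: measurable_act_inv.
Qed.

Lemma measurable_orbit (f : X -> R) x : measurable_fun [set: X] f ->
  measurable_fun [set: Borel G] (fun g : Borel G => f (act (inv g) x)).
Proof.
move=> mf; apply: measurableT_comp => //.
exact: (@measurable_fun_pair1 _ _ _ _ _ _
  (fun z : Borel G * X => act (inv z.1) z.2) x measurable_act_inv).
Qed.

(** For fixed [x] the averages are ball averages of the orbit function [h] to [f (act (inv h) x)],
    with [dist e] as the radius, so rational radii suffice. *)
Lemma measurable_maxfun_pi (I : set R) r (f : X -> R) :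
  I r -> (forall t, I t -> 0 < t)%R ->
  (forall t, I t -> t = r \/ exists2 s, (t < s)%R & [set` `]t, s[%R] `<=` I) ->
  measurable_fun [set: X] f ->
  measurable_fun [set: X] (maxfun I (fun t => pi_beta inv e mG dist act t f)).
Proof.
move=> Ir I0 openI mf; apply: (@measurable_maxfun _ _ _ I r) => //.
  by move=> t /I0 t0; exact: (measurable_pi_beta t f t0 mf).
move=> t It; have [->|[s ts sI]] := openI _ It; [by left|right].
exists s => // x; apply: (ball_avg_le_sup_rat _ _ _ mG (dist e)) => //.
- exact: measurable_orbit.
- exact: I0.
Qed.

Lemma act_inv_mul g h x : act (inv (mul g h)) x = act (inv h) (act (inv g) x).
Proof.
have [act1 actM _ _] := act_mp; have [mulA mul1 mulV] := Ggroup.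
have actK k y : act (inv k) (act k y) = y by rewrite -actM (mulV k).1 act1.
have xE : x = act (mul g h) (act (inv h) (act (inv g) x)).
  by rewrite actM -[act h _]actM (mulV h).2 act1 -actM (mulV g).2 act1.
by rewrite [in LHS]xE actK.
Qed.

Lemma rho_beta_orbit (r R0 t : R) (f : X -> R) x g :
  (0 < t <= r)%R -> B (R0 - r) g ->
  rho_beta mul e mG dist t
    (fun h : Borel G => \1_(B R0) h * f (act (inv h) x))%R g =
  pi_beta inv e mG dist act t f (act (inv g) x).
Proof.
move=> /andP[t0 tr] gR; rewrite /rho_beta /pi_beta; congr (_ * _).
apply: eq_integral => h; rewrite inE => ht; rewrite act_inv_mul.
(* It remains to see that the cut-off equals 1 at [mul g h], by the triangle inequality through
   [g]. *)
rewrite indicE mem_set ?mul1r//.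
have [_ _ dist_triangle dist_mul] := dist_left_inv.
have [_ mul1 _] := Ggroup.
have gh : dist g (mul g h) = dist e h by rewrite -{1}(mul1 g).2 dist_mul.
rewrite /cball/= in gR ht *; rewrite (le_trans (dist_triangle _ g _))// gh.
by rewrite -[leRHS](subrK r) lerD// (le_trans ht).
Qed.

(** * Transference of the maximal inequality from [G] to [X] *)

Variables (p C r : R).
Hypothesis p_gt1 : (1 < p)%R.
Hypothesis r_gt0 : (0 < r)%R.
Local Notation rho F := (fun t => rho_beta mul e mG dist t F).
Local Notation pi f := (fun t => pi_beta inv e mG dist act t f).
Hypothesis maximal_rho : forall F : Borel G -> R, measurable_fun [set: Borel G] F ->
  Lnorm mG p%:E (EFin \o F) < +oo ->
  Lnorm mG p%:E (maxfun [set` `]0, r]%R] (rho F)) <= C%:E * Lnorm mG p%:E (EFin \o F).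

Let p_gt0 : (0 < p)%R. Proof. exact: lt_trans p_gt1. Qed.
Let p_neq0 : p != 0%R. Proof. by rewrite gt_eqF. Qed.

(** The indicator of the unit ball has positive finite norm, so a negative [C] would make the right
    side of the maximal inequality negative. The sign is needed for taking p-th powers and roots of
    [C]. *)
Lemma maximal_const_ge0 : (0 <= C)%R.
Proof.
rewrite leNgt; apply/negP => C_lt0.
pose F : Borel G -> R := \1_(B 1%R).
have FE : \int[mG]_g `|(EFin \o F) g| `^ p = mG (B 1%R).
  have := integral_indic mG measurableT (measurable_ball _ ltr01).
  rewrite setIT => <-; apply: eq_integral => g _; rewrite /F /= indicE.
  by case: (g \in _); rewrite /= ?normr1 ?powR1 ?normr0 ?powR0.
have FNE : Lnorm mG p%:E (EFin \o F) = mG (B 1%R) `^ p^-1 by rewrite unlock FE.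
have mF : measurable_fun [set: Borel G] F.
  by apply: measurable_indic; exact: measurable_ball.
have Foo : Lnorm mG p%:E (EFin \o F) < +oo.
  by rewrite FNE; apply: poweR_lty; exact: ball_lty.
have := maximal_rho F mF Foo; rewrite FNE.
move=> /(le_trans (Lnorm_ge0 _ _ _)); apply/negP; rewrite -ltNge.
by rewrite nmule_rlt0 ?lte_fin// poweR_gt0// ball_gt0.
Qed.

Lemma maximal_orbit (f : X -> R) R0 x : (2 * r <= R0)%R ->
  measurable_fun [set: X] f ->
  \int[mG]_(g in B R0) `|(f (act (inv g) x))%:E| `^ p < +oo ->
  \int[mG]_(g in B (R0 - r)) `|maxfun [set` `]0, r]%R] (pi f) (act (inv g) x)| `^ p
    <= (C `^ p)%:E * \int[mG]_(g in B R0) `|(f (act (inv g) x))%:E| `^ p.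
Proof.
move=> rR0 mf; set J := (X in X < _) => Joo.
pose F (g : Borel G) : R := (\1_(B R0) g * f (act (inv g) x))%R.
have R0_gt0 : (0 < R0)%R by apply: lt_le_trans rR0; rewrite mulr_gt0.
(* The cut-off vanishes off [B R0], where the p-th power is 0 since [p] is nonzero. *)
have FE : Lnorm mG p%:E (EFin \o F) `^ p = J.
  rewrite (poweR_Lnorm mG _ p_neq0) /J [RHS]integral_mkcond; apply: eq_integral => g _.
  rewrite patchE /F /= indicE.
  by case: (g \in _); rewrite /= ?mul1r// mul0r normr0 powR0.
have mF : measurable_fun [set: Borel G] F.
  apply: measurable_funM; last exact: measurable_orbit.
  by apply: measurable_indic; exact: measurable_ball.
have Foo : Lnorm mG p%:E (EFin \o F) < +oo.
  by apply: (@lty_poweRy _ _ p) => //; rewrite FE.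
have := maximal_rho F mF Foo => /(gt0_ler_poweR (ltW p_gt0)).
rewrite !in_itv/= !leey !andbT Lnorm_ge0.
rewrite mule_ge0 ?lee_fin ?maximal_const_ge0 ?Lnorm_ge0//.
move=> /(_ isT isT); rewrite poweRM ?lee_fin ?maximal_const_ge0 ?Lnorm_ge0// FE.
apply: le_trans; rewrite (poweR_Lnorm mG _ p_neq0) [leLHS]integral_mkcond.
(* Off the inner ball the left integrand is 0; on it the two maximal functions coincide. *)
apply: (ge0_le_integral_nomeas _ _ _ mG setT) => g _; rewrite patchE; case: ifPn => // gB.
- exact: poweR_ge0.
- suff -> : maxfun [set` `]0, r]%R] (pi f) (act (inv g) x) =
      maxfun [set` `]0, r]%R] (rho F) g by [].
  congr ereal_sup; apply: eq_imagel => t /=; rewrite in_itv/= => tr.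
  by rewrite -(rho_beta_orbit r R0)//; exact/set_mem.
- exact: poweR_ge0.
Qed.

Lemma measurable_maxfun_pi_Ioc (f : X -> R) : measurable_fun [set: X] f ->
  measurable_fun [set: X] (maxfun [set` `]0, r]%R] (pi f)).
Proof.
apply: (measurable_maxfun_pi _ r).
- by rewrite /= in_itv/= r_gt0 lexx.
- by move=> t; rewrite /= in_itv/= => /andP[].
- move=> t; rewrite /= in_itv/= => /andP[t0]; rewrite le_eqVlt => /predU1P[->|tr].
    by left.
  right; exists r => // s; rewrite /= !in_itv/= => /andP[ts /ltW ->].
  by rewrite (lt_trans t0 ts).
Qed.

Lemma maximal_transfer_integral (f : X -> R) R0 : (2 * r <= R0)%R ->
  measurable_fun [set: X] f -> Lnorm m p%:E (EFin \o f) < +oo ->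
  mG (B (R0 - r)) * \int[m]_x `|maxfun [set` `]0, r]%R] (pi f) x| `^ p
    <= (C `^ p)%:E * (mG (B R0) * \int[m]_x `|(f x)%:E| `^ p).
Proof.
move=> rR0 mf foo.
have R0_gt0 : (0 < R0)%R by apply: lt_le_trans rR0; rewrite mulr_gt0.
(* From [2 * r <= R0] the inner radius is at least [r]. *)
have R0r_gt0 : (0 < R0 - r)%R.
  by rewrite subr_gt0 (lt_le_trans _ rR0)// mulr_natl mulr2n ltrDl.
have mB := measurable_ball _ R0_gt0; have mB' := measurable_ball _ R0r_gt0.
have mM : measurable_fun [set: X]
    (fun x => `|maxfun [set` `]0, r]%R] (pi f) x| `^ p).
  apply: (measurableT_comp (measurable_poweR p)).
  by apply: measurableT_comp => //; exact: measurable_maxfun_pi_Ioc.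
have mfp : measurable_fun [set: X] (fun x => `|(f x)%:E| `^ p).
  apply: (measurableT_comp (measurable_poweR p)).
  by apply: measurableT_comp => //; exact/measurable_EFinP.
have mavg (D : set (Borel G)) (K : X -> \bar R) : measurable D ->
    measurable_fun [set: X] K ->
    measurable_fun [set: X] (fun x => \int[mG]_(g in D) K (act (inv g) x)).
  move=> mD mK; apply: (@measurable_fun_integral_l _ _ _ _ _ mG D
    (fun z : Borel G * X => K (act (inv z.1) z.2)) sigma_finite_balls mD).
  by apply: measurableT_comp => //; exact: measurable_act_inv.
have foo' : \int[m]_x `|(f x)%:E| `^ p < +oo.
  rewrite -(poweR_Lnorm m (EFin \o f) p_neq0); exact: poweR_lty.
rewrite -!integral_act_inv//; [|by move=> x; exact: poweR_ge0 ..].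
rewrite -ge0_integralZl//; [|exact: (mavg _ _ mB mfp)
  |by move=> x _; apply: integral_ge0 => g _; exact: poweR_ge0
  |by rewrite lee_fin powR_ge0].
apply: ae_ge0_le_integral => //.
- by move=> x _; apply: integral_ge0 => g _; exact: poweR_ge0.
- exact: (mavg _ _ mB' mM).
- move=> x _; apply: mule_ge0; first by rewrite lee_fin powR_ge0.
  by apply: integral_ge0 => g _; exact: poweR_ge0.
- by apply: measurable_funeM; exact: (mavg _ _ mB mfp).
(* The orbit integrals of the p-th power of [f] have finite integral over [X], hence are finite for
   almost every [x]; at such [x] the inequality along the orbit applies. *)
have : m.-integrable [set: X]
    (fun x => \int[mG]_(g in B R0) `|(f (act (inv g) x))%:E| `^ p).
  apply/integrableP; split; first exact: (mavg _ _ mB mfp).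
  rewrite (eq_integral (fun x => \int[mG]_(g in B R0) `|(f (act (inv g) x))%:E| `^ p)).
    rewrite (integral_act_inv _ (fun y => `|(f y)%:E| `^ p))//; last first.
      by move=> y; exact: poweR_ge0.
    by rewrite lte_mul_pinfty// ge0_fin_numE// ball_lty.
  by move=> x _; rewrite gee0_abs// integral_ge0// => g _; exact: poweR_ge0.
move=> /(integrable_ae measurableT); apply: filterS => x + _ => /(_ I) Jfin.
by apply: maximal_orbit => //; rewrite ltey_eq Jfin.
Qed.

(** Divides the integrated inequality by the finite positive mass of the inner ball and takes p-th
    roots. *)
Lemma maximal_transfer (f : X -> R) R0 : (2 * r <= R0)%R ->
  measurable_fun [set: X] f -> Lnorm m p%:E (EFin \o f) < +oo ->
  Lnorm m p%:E (maxfun [set` `]0, r]%R] (pi f)) <=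
    (C * powR (fine (mG (B R0)) / fine (mG (B (R0 - r)))) p^-1)%:E *
    Lnorm m p%:E (EFin \o f).
Proof.
move=> rR0 mf foo; have := maximal_transfer_integral f R0 rR0 mf foo.
have R0_gt0 : (0 < R0)%R by apply: lt_le_trans rR0; rewrite mulr_gt0.
have R0r_gt0 : (0 < R0 - r)%R.
  by rewrite subr_gt0 (lt_le_trans _ rR0)// mulr_natl mulr2n ltrDl.
have fineB t : (0 < t)%R -> (0 < fine (mG (B t)))%R.
  by move=> t0; rewrite fine_gt0// ball_gt0//= ball_lty.
have BE t : (0 < t)%R -> mG (B t) = (fine (mG (B t)))%:E.
  by move=> t0; rewrite fineK// ge0_fin_numE// ball_lty.
rewrite (BE _ R0_gt0) (BE _ R0r_gt0).
have a0 := fineB _ R0_gt0; have b0 := fineB _ R0r_gt0.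
set a := fine (mG (B R0)) in a0 *; set b := fine (mG (B (R0 - r))) in b0 *.
have C0 := maximal_const_ge0.
rewrite muleA -EFinM unlock.
set P := \int[m]_x _; set Q := \int[m]_x _ => PQ.
have P0 : 0 <= P by apply: integral_ge0 => x _; exact: poweR_ge0.
have Q0 : 0 <= Q by apply: integral_ge0 => x _; exact: poweR_ge0.
have {}PQ : P <= (C `^ p * (a / b))%:E * Q.
  by rewrite mulrA [X in X%:E]mulrC EFinM -muleA lee_pdivlMl.
have ab0 : (0 <= a / b)%R by rewrite divr_ge0// ltW.
have k0 : (0 <= C `^ p * (a / b))%R by rewrite mulr_ge0// powR_ge0.
have p0 : (0 <= p^-1)%R by rewrite invr_ge0 ltW.
apply: (@le_trans _ _ (((C `^ p * (a / b))%:E * Q) `^ p^-1)).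
  by apply: gt0_ler_poweR => //; rewrite in_itv/= leey andbT// mule_ge0.
rewrite poweRM// poweR_EFin powRM ?powR_ge0//.
by rewrite -powRrM mulfV// powRr1.
Qed.

End action_averages.

(** * Both maximal inequalities for actions: fixed radius bound, then all radii *)

Theorem theorem5p9 (R : realType) (G : ptopologicalType)
  (mul : G -> G -> G) (inv : G -> G) (e : G)
  (mG : {measure set (Borel G) -> \bar R}) (dist : G -> G -> R)
  (p C : R) :
  lcsc_group mul inv e ->
  unimodular_haar mul mG ->
  left_inv_metric mul dist ->
  (forall t, 0 < t -> compact (cball e dist t) /\ (0 < mG (cball e dist t))%E) ->
  1 < p ->
  let maximal_ineq (r : R) : Prop :=
    forall F : Borel G -> R, measurable_fun [set: Borel G] F ->
      (Lnorm mG p%:E (EFin \o F) < +oo)%E ->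
      (Lnorm mG p%:E (maxfun [set` `]0, r]%R] (fun t => rho_beta mul e mG dist t F))
        <= C%:E * Lnorm mG p%:E (EFin \o F))%E in
  (* (1) *)
  (forall r, 0 < r -> maximal_ineq r ->
    forall dX (X : measurableType dX) (m : {measure set X -> \bar R})
      (act : G -> X -> X),
      sigma_finite [set: X] m -> mp_action mul e m act ->
      forall f : X -> R, measurable_fun [set: X] f ->
      (Lnorm m p%:E (EFin \o f) < +oo)%E ->
      forall R0, 2 * r <= R0 ->
      (Lnorm m p%:E (maxfun [set` `]0, r]%R] (fun t => pi_beta inv e mG dist act t f))
        <= (C * powR (fine (mG (cball e dist R0)) /
                      fine (mG (cball e dist (R0 - r)))) p^-1)%:E
           * Lnorm m p%:E (EFin \o f))%E)
  /\
  (* (2) *)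
  ((forall r, 0 < r ->
      (fun R0 : R => fine (mG (cball e dist R0)) /
                     fine (mG (cball e dist (R0 - r)))) x @[x --> +oo]
      --> (1 : R)) ->
   (forall r, 0 < r -> maximal_ineq r) ->
   forall dX (X : measurableType dX) (m : {measure set X -> \bar R})
      (act : G -> X -> X),
      sigma_finite [set: X] m -> mp_action mul e m act ->
      forall f : X -> R, measurable_fun [set: X] f ->
      (Lnorm m p%:E (EFin \o f) < +oo)%E ->
      (Lnorm m p%:E (maxfun [set` `]0%R, +oo[%R] (fun t => pi_beta inv e mG dist act t f))
        <= C%:E * Lnorm m p%:E (EFin \o f))%E).
Proof.
move=> [Ggroup _ inv_cont haus _] [_ _ haar_lty _] dist_inv balls p1 maximal_ineq.
have mB t : 0 < t -> measurable (cball e dist t : set (Borel G)).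
  (* Balls are Borel because compact sets in a Hausdorff space are closed. *)
  move=> /balls[cB _]; apply: closed_borel_measurable.
  exact: compact_closed haus cB.
have B_lty t : 0 < t -> (mG (cball e dist t) < +oo)%E.
  by move=> /balls[cB _]; exact: haar_lty.
have B_gt0 t : 0 < t -> (0 < mG (cball e dist t))%E by move=> /balls[].
have part1 r (r0 : 0 < r) (max_r : maximal_ineq r) dX (X : measurableType dX)
    (m : {measure set X -> \bar R}) act (sf : sigma_finite [set: X] m)
    (mp : mp_action mul e m act) :=
  maximal_transfer R G mul inv e mG dist Ggroup inv_cont dist_inv mB B_lty B_gt0
    m act sf mp p C r p1 r0 max_r.
split=> [r r0 max_r dX X m act sf mp f mf foo R0 rR0
  |ratio max_all dX X m act sf mp f mf foo].
  exact: part1.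
have p0 : 0 < p by exact: lt_trans p1.
have C0 : 0 <= C.
  apply: (maximal_const_ge0 R G mul e mG dist mB B_lty B_gt0 p C 1) => //.
  exact: max_all.
set N := Lnorm m p%:E (EFin \o f) in foo *.
have NE : N = (fine N)%:E by rewrite fineK// ge0_fin_numE// Lnorm_ge0.
have part2 r : 0 < r -> (Lnorm m p%:E (maxfun [set` `]0%R, r]%R]
    (fun t => pi_beta inv e mG dist act t f)) <= C%:E * N)%E.
  move=> r0; pose u R0 :=
    fine (mG (cball e dist R0)) / fine (mG (cball e dist (R0 - r))).
  have uC : (C * u x * fine N)%:E @[x --> +oo] --> (C * 1 * fine N)%:E.
    apply: cvg_EFin; first exact: nearW.
    apply: cvgM; last exact: cvg_cst.
    by apply: cvgM; [exact: cvg_cst|exact: ratio].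
  rewrite NE -EFinM -[X in (X * _)%:E]mulr1; apply: cvge_ge uC.
  near=> R0.
  have rR0 : 2 * r <= R0 by near: R0; apply: nbhs_pinfty_ge; rewrite num_real.
  apply: (le_trans (part1 r r0 (max_all r r0) dX X m act sf mp f R0 rR0 mf foo)).
  rewrite -/N [in leLHS]NE -EFinM lee_fin ler_wpM2r ?fine_ge0 ?Lnorm_ge0//.
  rewrite ler_wpM2l//.
  have R0r : 0 < R0 - r.
    by rewrite subr_gt0 (lt_le_trans _ rR0)// mulr_natl mulr2n ltrDl.
  have R0_gt0 : 0 < R0 by rewrite (lt_trans R0r)// ltrBlDr ltrDl.
  have u1 : 1 <= u R0.
    rewrite ler_pdivlMr ?mul1r; last by rewrite fine_gt0// B_gt0//= B_lty.
    apply: fine_le; [by rewrite ge0_fin_numE// B_lty..|].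
    apply: le_measure; [by rewrite inE; exact: mB..|].
    by move=> g /= gR; apply: le_trans gR _; rewrite lerBlDr lerDl ltW.
  rewrite -[leRHS]powRr1; last exact: le_trans u1.
  by rewrite ler_powR// invf_le1// ltW.
pose M n := maxfun [set` `]0%R, n.+1%:R]%R] (fun t => pi_beta inv e mG dist act t f).
have I1 : (1 : R) \in `]0, +oo[ by rewrite in_itv/= ltr01.
apply: (Lnorm_sup_le _ _ _ m p M) => //.
- move=> n; exact: (measurable_maxfun_pi_Ioc R G mul inv e mG dist inv_cont
    mB B_lty B_gt0 m act mp).
- move=> n x; apply: (maxfun_ge0 _ _ _ n.+1%:R).
  by rewrite /= in_itv/= lexx ltr0n.
- move=> x k n kn; apply: le_ereal_sup => _ [t + <-].
  rewrite /= in_itv/= => /andP[t0 tk].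
  by exists t => //=; rewrite in_itv/= t0 (le_trans tk)// ler_nat ltnS.
- move=> x; rewrite (maxfun_ge0 _ _ _ 1)//=.
  apply: ge_ereal_sup => _ [t /= + <-]; rewrite in_itv/= andbT => t0.
  (* [M n] covers radii up to [n.+1], and [t] is below its integer part plus one. *)
  apply: (@le_trans _ _ (M (Num.truncn t) x)).
    apply: ereal_sup_ubound; exists t => //=; rewrite in_itv/= t0 /=.
    by rewrite ltW// truncnS_gt.
  by apply: ereal_sup_ubound; exists (Num.truncn t).
- by move=> n; exact: part2.
Unshelve. all: by end_near.
Qed.
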